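(* For every integer $n\ge 1$, \[ \sum_{\sigma \in \mathrm{And}^{I}_n} s^{\mathrm{ides}(\sigma)}t^{\mathrm{des}(\sigma)} q^{\mathrm{maj}(\sigma)} =\sum_{\sigma \in \mathrm{And}^{II}_n} s^{\mathrm{ides}(\sigma)}t^{\mathrm{des}(\sigma)} q^{\mathrm{maj}(\sigma)} =\sum_{\sigma \in \mathrm{RS}_{n}} s^{\mathrm{ides}(\sigma)}t^{\mathrm{des}(\sigma)} q^{\mathrm{maj}(\sigma)} \] as polynomials in $s,t,q$.
   Context: A ''permutation'' of length $n$ here may be any word of $n$ distinct integers. The empty word and every one-letter word are both Andr\'e I and Andr\'e II permutations. A word $\sigma$ of $n\ge 2$ distinct integers is written uniquely as $\sigma=\tau\,\min(\sigma)\,\tau'$. Then $\sigma$ is an Andr\'e I permutation if $\tau$ and $\tau'$ are Andr\'e I permutations and the largest letter of the word $\tau\tau'$ lies in $\tau'$; $\sigma$ is an Andr\'e II permutation if $\tau$ and $\tau'$ are Andr\'e II permutations and the smallest letter of $\tau\tau'$ lies in $\tau'$. $\mathrm{And}^{I}_n$ (resp. $\mathrm{And}^{II}_n$) is the set of Andr\'e I (resp. Andr\'e II) permutations of $[n]=\{1,\dots,n\}$. A permutation $\sigma=\sigma_1\cdots\sigma_n$ of $[n]$ is a simsun permutation if $\sigma_n=n$ and, for every $k\in\{1,\dots,n\}$, the subword of $\sigma$ formed by the letters $1,\dots,k$ has no double descent (a double descent of a word $w_1\cdots w_m$ is an index $i$ with $w_i>w_{i+1}>w_{i+2}$). $\mathrm{RS}_n$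 is the set of simsun permutations of $[n]$. For $\sigma=\sigma_1\cdots\sigma_n$: $\mathrm{Des}(\sigma)=\{i\in[n-1]:\sigma_i>\sigma_{i+1}\}$, $\mathrm{des}(\sigma)=|\mathrm{Des}(\sigma)|$, $\mathrm{maj}(\sigma)=\sum_{i\in\mathrm{Des}(\sigma)} i$, and $\mathrm{ides}(\sigma)=\mathrm{des}(\sigma^{-1})$, the number of descents of the inverse permutation. *)

(* Defs.v *)
From HB Require Import structures.
From mathcomp Require Import all_boot all_order all_algebra.
From mathcomp Require Import mpoly.
Set Implicit Arguments. Unset Strict Implicit. Unset Printing Implicit Defensive.
Import Order.TTheory GRing.Theory Num.Theory.

Definition wmin (w : seq nat) : nat := foldr minn (head 0 w) w.
Definition wmax (w : seq nat) : nat := foldr maxn 0 w.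

Definition left_part (w : seq nat) : seq nat := take (index (wmin w) w) w.
Definition right_part (w : seq nat) : seq nat := drop (index (wmin w) w).+1 w.

(* Andre I: tau, tau' Andre I and max letter of tau tau' lies in tau'.
   Recursion with fuel; fuel = size w suffices since parts are shorter. *)
Fixpoint andreI_rec (k : nat) (w : seq nat) : bool :=
  match k with
  | 0 => true
  | k'.+1 =>
    if size w <= 1 then true else
    [&& andreI_rec k' (left_part w), andreI_rec k' (right_part w)
      & wmax (left_part w ++ right_part w) \in right_part w]
  end.
Definition andreI (w : seq nat) : bool := andreI_rec (size w) w.

Fixpoint andreII_rec (k : nat) (w : seq nat) : bool :=
  match k with
  | 0 => true
  | k'.+1 =>
    if size w <= 1 then true else
    [&& andreII_rec k' (left_part w), andreII_rec k' (right_part w)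
      & wmin (left_part w ++ right_part w) \in right_part w]
  end.
Definition andreII (w : seq nat) : bool := andreII_rec (size w) w.

Definition has_double_descent (w : seq nat) : bool :=
  has (fun i => (nth 0 w i > nth 0 w i.+1) && (nth 0 w i.+1 > nth 0 w i.+2))
      (iota 0 (size w).-2).

Definition simsun (n : nat) (w : seq nat) : bool :=
  (last 0 w == n) &&
  all (fun k => ~~ has_double_descent [seq x <- w | x <= k]) (iota 1 n).

(* Des(sigma) as a list of 1-based positions i in [n-1] with sigma_i > sigma_{i+1} *)
Definition Des (w : seq nat) : seq nat :=
  [seq i <- iota 1 (size w).-1 | nth 0 w i.-1 > nth 0 w i].
Definition des (w : seq nat) : nat := size (Des w).
Definition maj (w : seq nat) : nat := sumn (Des w).

Definition inv_word (w : seq nat) : seq nat :=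
  [seq (index j w).+1 | j <- iota 1 (size w)].
Definition ides (w : seq nat) : nat := des (inv_word w).

Definition perms (n : nat) : seq (seq nat) := permutations (iota 1 n).

Local Open Scope ring_scope.
Definition stq_weight (w : seq nat) : {mpoly int[3]} :=
  'X_(inord 0) ^+ ides w * 'X_(inord 1) ^+ des w * 'X_(inord 2) ^+ maj w.

(* Main.v *)
(** The three sets have the same joint distribution of [ides] and of the whole
    descent set. A permutation of length [n] with [d] inverse descents is the
    standardisation of [binomial (m - d + n - 1) n] words over [m] letters, with
    the same descents; this matrix is unitriangular in [d], so it suffices to
    count, for each [m] and each descent set, the words whose standardisation
    lies in each class.

    Split a word at its leftmost minimum: [w = t l w']. Call [w] an A-chain if it
    is empty, or if [t] belongs to A and [w'] is an A-chain. André I words are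
    the chains of André I words followed by a letter that is at least their
    maximum. The words of which no restriction to small letters has a double
    descent or a final descent are the André II words, hence simsun words are
    the chains of André II words followed by a maximum. Finally, in an André II
    word [t l w'] the factor [t] is empty or lies above the minimum of [w'].
    Decomposing [w'] as well, the generating function of the André II words with
    minimum [l] satisfies the recursion of the generating function of chains. *)

Require Import Defs.
From mathcomp Require Import all_boot all_order all_algebra.
From mathcomp Require Import mpoly.
From mathcomp Require Import zify.
Set Implicit Arguments. Unset Strict Implicit. Unset Printing Implicit Defensive.
Import GRing.Theory.
Local Open Scope nat_scope.

(** * Splitting words at the leftmost minimum *)

(** Strictness on the left and weakness on the right single out the leftmost minimum, so the
    splitting is unambiguous also when letters repeat. *)
Lemma min_split_ind (P : seq nat -> Type) :
  P [::] ->
  (forall t l w, all (ltn l) t -> all (leq l) w -> P t -> P w ->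
     P (t ++ l :: w)) ->
  forall w, P w.
Proof.
move=> P0 PS w; have [n] := ubnP (size w); elim: n w => // n IHn w.
have [->|w0 sw] := eqVneq w [::]; first by [].
have exm : exists k, k \in w by case: w w0 sw => // x w _ _; exists x; rewrite mem_head.
have [l lw lmin] := ex_minnP exm.
have li : index l w < size w by rewrite index_mem.
have wE : w = take (index l w) w ++ l :: drop (index l w).+1 w.
  by rewrite -[X in X :: _](nth_index 0 lw) -drop_nth // cat_take_drop.
rewrite wE; apply: PS.
- apply/allP => x xt /=; rewrite ltn_neqAle lmin ?andbT; last exact: mem_take xt.
  by apply: contraL xt => /eqP <-; rewrite in_take ?ltnn // ltnW.
- by apply/allP => x /mem_drop /lmin.
- by apply: IHn; rewrite size_take li; lia.
- by apply: IHn; rewrite size_drop; lia.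
Qed.

Lemma wmin_split t l w :
  all (ltn l) t -> all (leq l) w -> wmin (t ++ l :: w) = l.
Proof.
have ge z s : all (leq l) s -> l <= z -> l <= foldr minn z s.
  by move=> + lz; elim: s => //= y s IH /andP[ly /IH]; rewrite leq_min ly.
have H z s : all (leq l) s -> l <= z -> l \in s -> foldr minn z s = l.
  move=> + lz; elim: s => //= x s IHs /andP[lx ls]; rewrite in_cons.
  case/predU1P=> [<-|/(IHs ls) ->]; last exact/minn_idPr.
  exact/minn_idPl/ge.
move=> lt lw; apply: H; last by rewrite mem_cat mem_head orbT.
  rewrite all_cat /= leqnn lw !andbT.
  by apply: sub_all lt => x /=; apply: ltnW.
by case: t lt => //= x t /andP[/ltnW].
Qed.

Lemma parts_split t l w : all (ltn l) t -> all (leq l) w ->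
  left_part (t ++ l :: w) = t /\ right_part (t ++ l :: w) = w.
Proof.
move=> lt lw; rewrite /left_part /right_part wmin_split //.
have lNt : l \notin t by apply/negP => /(allP lt); rewrite /= ltnn.
rewrite index_cat (negPf lNt) /= eqxx addn0 take_size_cat //; split=> //.
by rewrite drop_cat ltnNge leqnSn /= subSnn /= drop0.
Qed.

(* [b = true] is the André I condition: the largest letter is on the right,
   i.e. some letter of [w] dominates [t]. [b = false] is André II. Ties are
   broken from left to right, as in the standardisation of a word. *)
Definition right_wins (b : bool) (t w : seq nat) :=
  nilp t || has (fun y => all (fun x => (x <= y) == b) t) w.

(** The empty word is the only base case: in a one-letter word the left part is empty and
    [right_wins] holds. *)
Fixpoint andre_rec b k w :=
  if k is k'.+1 then
    nilp w || [&& andre_rec b k' (left_part w), andre_rec b k' (right_part w)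
                & right_wins b (left_part w) (right_part w)]
  else true.
Definition andre b w := andre_rec b (size w) w.

Fixpoint chain_rec b k w :=
  if k is k'.+1 then
    nilp w || (andre b (left_part w) && chain_rec b k' (right_part w))
  else true.
Definition chain b w := chain_rec b (size w) w.

Lemma nilp_split (t : seq nat) l w : nilp (t ++ l :: w) = false.
Proof. by case: t. Qed.

Lemma andre_rec_fuel b k w : size w <= k -> andre_rec b k w = andre b w.
Proof.
rewrite /andre; have [n] := ubnP (size w); elim: n w k => // n IHn w k.
elim/min_split_ind: w => [|t l w lt lw _ _]; first by case: k.
case: k => [|k]; rewrite size_cat //= !addnS //= => sn sk.
have [-> ->] := parts_split lt lw; rewrite nilp_split /=.
have E s : size s <= size t + size w -> andre_rec b k s = andre_rec b (size t + size w) s.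
  by move=> le_s; rewrite [RHS]IHn ?IHn //; lia.
by rewrite !E //; lia.
Qed.

Lemma andreE b t l w : all (ltn l) t -> all (leq l) w ->
  andre b (t ++ l :: w) = [&& andre b t, andre b w & right_wins b t w].
Proof.
move=> lt lw; rewrite {1}/andre size_cat /= addnS /=.
have [-> ->] := parts_split lt lw; rewrite nilp_split /=.
by rewrite !andre_rec_fuel //; lia.
Qed.

Lemma chain_rec_fuel b k w : size w <= k -> chain_rec b k w = chain b w.
Proof.
rewrite /chain; have [n] := ubnP (size w); elim: n w k => // n IHn w k.
elim/min_split_ind: w => [|t l w lt lw _ _]; first by case: k.
case: k => [|k]; rewrite size_cat //= !addnS //= => sn sk.
have [-> ->] := parts_split lt lw; rewrite nilp_split /=.
by rewrite (IHn w k) ?(IHn w (_ + _)) //; lia.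
Qed.

Lemma chainE b t l w : all (ltn l) t -> all (leq l) w ->
  chain b (t ++ l :: w) = andre b t && chain b w.
Proof.
move=> lt lw; rewrite {1}/chain size_cat /= addnS /=.
have [-> ->] := parts_split lt lw; rewrite nilp_split /=.
by rewrite !chain_rec_fuel //; lia.
Qed.

(** * Agreement with the definitions of André words *)

Lemma wmax_ge w x : x \in w -> x <= wmax w.
Proof.
elim: w => //= y w IHw; rewrite in_cons => /orP[/eqP->|/IHw].
  exact: leq_maxl.
by move/leq_trans; apply; apply: leq_maxr.
Qed.

Lemma wmax_mem w : w != [::] -> wmax w \in w.
Proof.
elim: w => //= y w IHw _; rewrite in_cons; case: (leqP (wmax w) y).
  by rewrite eqxx.
move=> yw; have w0 : w != [::] by case: w yw {IHw}.
by rewrite IHw ?orbT.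
Qed.

Lemma wmin_le w x : x \in w -> wmin w <= x.
Proof.
elim/min_split_ind: w => // t l w lt lw _ _; rewrite wmin_split //.
by rewrite mem_cat in_cons => /or3P[/(allP lt)/ltnW|/eqP->|/(allP lw)].
Qed.

Lemma wmin_mem w : w != [::] -> wmin w \in w.
Proof.
elim/min_split_ind: w => // t l w lt lw _ _ _.
by rewrite wmin_split // mem_cat mem_head orbT.
Qed.

(** If the maximum lies in [t], a letter of [w] dominating [t] must equal it. *)
Lemma wmax_right t w : (t ++ w != [::]) ->
  (wmax (t ++ w) \in w) = right_wins true t w.
Proof.
move=> tw0; apply/idP/idP => [H|].
  apply/orP; right; apply/hasP; exists (wmax (t ++ w)) => //.
  by apply/allP => x xt; rewrite wmax_ge // mem_cat xt.
have := wmax_mem tw0; rewrite mem_cat => /orP[mt|//].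
move=> /orP[/nilP t0|/hasP[y yw /allP/(_ _ mt)]]; first by rewrite t0 in mt.
rewrite eqb_id => my; suff -> : wmax (t ++ w) = y by [].
by apply/eqP; rewrite eqn_leq my wmax_ge // mem_cat yw orbT.
Qed.

(** [right_wins false] asks for a letter strictly below all of [t]; by distinctness the minimum of
    [t ++ w] is one as soon as it lies in [w]. *)
Lemma wmin_right t w : (t ++ w != [::]) -> uniq (t ++ w) ->
  (wmin (t ++ w) \in w) = right_wins false t w.
Proof.
move=> tw0; rewrite cat_uniq => /and3P[_ /hasPn dis _]; apply/idP/idP => [H|].
  apply/orP; right; apply/hasP; exists (wmin (t ++ w)) => //.
  apply/allP => x xt; rewrite eqbF_neg -ltnNge ltn_neqAle wmin_le ?mem_cat ?xt //.
  by rewrite andbT; apply: contraTneq xt => <-; apply: dis.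
have := wmin_mem tw0; rewrite mem_cat => /orP[mt|//].
move=> /orP[/nilP t0|/hasP[y yw /allP/(_ _ mt)]]; first by rewrite t0 in mt.
by rewrite eqbF_neg wmin_le // mem_cat yw orbT.
Qed.

Lemma andreI_rec_fuel k w : size w <= k -> andreI_rec k w = andreI w.
Proof.
rewrite /andreI; have [n] := ubnP (size w); elim: n w k => // n IHn w k.
elim/min_split_ind: w => [|t l w lt lw _ _]; first by case: k.
case: k => [|k]; rewrite size_cat //= !addnS //= => sn sk.
rewrite size_cat /=; case: ifP => // _.
have [-> ->] := parts_split lt lw.
have E s : size s <= size t + size w -> andreI_rec k s = andreI_rec (size t + size w) s.
  by move=> le_s; rewrite [RHS]IHn ?IHn //; lia.
by rewrite !E //; lia.
Qed.

Lemma andreII_rec_fuel k w : size w <= k -> andreII_rec k w = andreII w.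
Proof.
rewrite /andreII; have [n] := ubnP (size w); elim: n w k => // n IHn w k.
elim/min_split_ind: w => [|t l w lt lw _ _]; first by case: k.
case: k => [|k]; rewrite size_cat //= !addnS //= => sn sk.
rewrite size_cat /=; case: ifP => // _.
have [-> ->] := parts_split lt lw.
have E s : size s <= size t + size w -> andreII_rec k s = andreII_rec (size t + size w) s.
  by move=> le_s; rewrite [RHS]IHn ?IHn //; lia.
by rewrite !E //; lia.
Qed.

Lemma andreI_andre w : andreI w = andre true w.
Proof.
elim/min_split_ind: w => // t l w lt lw IHt IHw.
rewrite andreE // -IHt -IHw {1}/andreI size_cat /= addnS /= size_cat /=.
have [-> ->] := parts_split lt lw; rewrite !andreI_rec_fuel; try lia.
case: ifP => [|sz]; last by rewrite wmax_right //; apply/eqP => /(congr1 size); rewrite size_cat /=; lia.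
by case: t w {lt lw IHt IHw} => [|? ?] [|? ?] //=; lia.
Qed.

Lemma andreII_andre w : uniq w -> andreII w = andre false w.
Proof.
elim/min_split_ind: w => // t l w lt lw IHt IHw.
rewrite cat_uniq /= negb_or => /and3P[ut /andP[_ dis] /andP[_ uw]].
rewrite andreE // -IHt // -IHw // {1}/andreII size_cat /= addnS /= size_cat /=.
have [-> ->] := parts_split lt lw; rewrite !andreII_rec_fuel; try lia.
case: ifP => [|sz].
  by case: t w {lt lw IHt IHw dis ut uw} => [|? ?] [|? ?] //=; lia.
rewrite wmin_right // ?cat_uniq ?ut ?dis //.
by apply/eqP => /(congr1 size); rewrite size_cat /=; lia.
Qed.

(** If [l <= t], appending [t] to [s ++ l :: w] lengthens only the right factor; by induction [t]
    must bound [w], and then some letter on the right dominates [s] exactly when [t] does. If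
    [t < l], then [t] is the new minimum with a nonempty word on its left and nothing on its
    right. *)
Lemma andre_rcons w t :
  andre true (rcons w t) = all (geq t) w && chain true w.
Proof.
elim/min_split_ind: w => [|s l w ls lw IHs IHw].
  by rewrite (@andreE true [::]).
have [lt|tl] := leqP l t; last first.
  rewrite -cats1 andreE //.
    by rewrite /right_wins nilp_split /= !andbF all_cat /= leqNgt tl andbF.
  rewrite all_cat /= tl /=; apply/andP; split.
    by apply: sub_all ls => x /=; apply: ltn_trans.
  by apply: sub_all lw => x /=; apply: leq_trans.
rewrite rcons_cat /= andreE ?all_rcons ?lt //= IHw chainE // all_cat /= lt /=.
case: (andre true s); rewrite /= ?andbF //.
case: (chain true w); rewrite /= ?andbF // !andbT.
have [tw|] := boolP (all (geq t) w); rewrite /= ?andbF ?andbT //.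
rewrite /right_wins has_rcons; case: s ls IHs => //= x s _ _.
apply/orP/idP => [[/andP[]|/hasP[y /(allP tw) /= yt /andP[]]]|].
- by rewrite eqb_id => -> /=; apply: sub_all => z; rewrite eqb_id.
- rewrite eqb_id => xy H; rewrite (leq_trans xy yt) /=.
  by apply: sub_all H => z; rewrite eqb_id => /leq_trans; apply.
by case/andP=> xt H; left; rewrite eqb_id xt; apply: sub_all H => z; rewrite eqb_id.
Qed.

(** Imposed on pairs with [x] left of [y], this lets [f] identify two letters only if they increase
    from left to right, as standardisation does. *)
Definition keeps_order (f : nat -> nat) : rel nat :=
  fun x y => (f x <= f y) == (x <= y).

Lemma right_wins_map f b t w : allrel (keeps_order f) t w ->
  right_wins b (map f t) (map f w) = right_wins b t w.
Proof.
move=> /allrelP tw; rewrite /right_wins /nilp size_map has_map; congr (_ || _).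
apply: eq_in_has => y yw; rewrite /= all_map; apply: eq_in_all => x xt /=.
by rewrite (eqP (tw _ _ xt yw)).
Qed.

Lemma pairwise_split f t l w : all (ltn l) t -> all (leq l) w ->
  pairwise (keeps_order f) (t ++ l :: w) ->
  [/\ all (ltn (f l)) (map f t), all (leq (f l)) (map f w),
      pairwise (keeps_order f) t, pairwise (keeps_order f) w
    & allrel (keeps_order f) t w].
Proof.
move=> lt lw; rewrite pairwise_cat allrel_consr pairwise_cons.
move=> /and3P[/andP[tl tw] pt /andP[plw pw]]; split=> //.
- rewrite all_map; apply/allP => x xt /=.
  by rewrite ltnNge (eqP (allP tl _ xt)) -ltnNge; apply: (allP lt).
- rewrite all_map; apply/allP => x xw /=.
  by rewrite (eqP (allP plw _ xw)) (allP lw).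
Qed.

(** Splitting and [right_wins] only test [x <= y] for [x] left of [y]. *)
Lemma andre_map f b w : pairwise (keeps_order f) w ->
  andre b (map f w) = andre b w.
Proof.
elim/min_split_ind: w => // t l w lt lw IHt IHw.
move=> /(pairwise_split lt lw)[flt flw pt pw tw].
by rewrite map_cat /= !andreE // IHt // IHw // right_wins_map.
Qed.

Lemma chain_map f b w : pairwise (keeps_order f) w ->
  chain b (map f w) = chain b w.
Proof.
elim/min_split_ind: w => // t l w lt lw IHt IHw.
move=> /(pairwise_split lt lw)[flt flw pt pw tw].
by rewrite map_cat /= !chainE // andre_map // IHw.
Qed.

(** * Simsun permutations as chains *)

Local Notation hdd := has_double_descent.

Lemma hdd_cons x y z w :
  hdd [:: x, y, z & w] = ((y < x) && (z < y)) || hdd [:: y, z & w].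
Proof. by rewrite /hdd /= (iotaDl 1 0) has_map. Qed.

Lemma hdd_cons_le x w : all (leq x) w -> hdd (x :: w) = hdd w.
Proof. by case: w => [|y [|z w]] //= /andP[xy _]; rewrite hdd_cons ltnNge xy. Qed.

Lemma hdd_cons_head x y w : x <= y -> hdd [:: x, y & w] = hdd (y :: w).
Proof. by case: w => [|z w] //= xy; rewrite hdd_cons ltnNge xy. Qed.

Lemma hdd_rcons_ge w x : all (geq x) w -> hdd (rcons w x) = hdd w.
Proof.
elim: w => // y [|z [|z' w]] IHw //= /and3P[xy xz xw].
  by rewrite hdd_cons [x < z]ltnNge xz andbF.
by rewrite !hdd_cons -IHw //= xz.
Qed.

(** Three consecutive letters contained in neither piece are centred at [m], and their first descent
    is automatic since [t] lies above [m]. *)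
Lemma hdd_cat t m v : all (ltn m) t ->
  hdd (t ++ m :: v) = [|| hdd (rcons t m), hdd (m :: v)
                        | ~~ nilp t && (if v is y :: _ then y < m else false)].
Proof.
elim: t => [|x [|y t] IHt]; first by rewrite orbF.
  by case: v {IHt} => [|y v] //= /andP[mx _]; rewrite hdd_cons mx orbC.
move=> /= /andP[mx myt]; have /= {IHt}IH := IHt myt.
case: t {myt} IH => [|z t] /= IH; rewrite !hdd_cons IH !orbA //.
by rewrite (_ : hdd [:: y; m] = false) ?orbF.
Qed.

Lemma hdd_split t m w : all (ltn m) t -> all (leq m) w ->
  hdd (t ++ m :: w) = hdd (rcons t m) || hdd w.
Proof.
move=> mt mw; rewrite hdd_cat // hdd_cons_le //; congr (_ || _).
by case: w mw => [|y w] /=; rewrite ?andbF ?orbF // ltnNge => /andP[-> _]; rewrite andbF orbF.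
Qed.

Lemma hdd_split_rcons t m w z : all (ltn m) t -> all (leq m) w -> z < m ->
  hdd (t ++ m :: rcons w z) =
  [|| hdd (rcons t m), hdd (rcons w z) | nilp w && ~~ nilp t].
Proof.
move=> mt mw zm; rewrite hdd_cat //; congr (_ || _).
case: w mw => [|y w] /=; first by rewrite zm andbT.
by case/andP=> my _; rewrite hdd_cons_head // ltnNge my andbF.
Qed.

(** * Restrictions to small letters *)

Definition upto k (w : seq nat) := [seq x <- w | x <= k].

Lemma upto_nil k w : all (ltn k) w -> upto k w = [::].
Proof.
move=> kw; apply/eqP; rewrite -[_ == _]negbK -has_filter -all_predC.
by apply: sub_all kw => x /=; rewrite ltnNge.
Qed.

Lemma all_upto a k w : all a w -> all a (upto k w).
Proof. by rewrite all_filter; apply: sub_all => x /= ->; rewrite implybT. Qed.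

(** A letter of [w] below all of [t] survives whenever a letter of [t] does. Conversely the
    threshold [wmin t] yields such a letter, strictly below [t] by distinctness. *)
Lemma right_wins_upto t w : uniq (t ++ w) ->
  reflect (forall k, nilp (upto k w) -> nilp (upto k t)) (right_wins false t w).
Proof.
rewrite cat_uniq => /and3P[_ /hasPn dis _].
apply: (iffP orP) => [[/nilP -> //|/hasP[y yw yt] k /nilP wk]|H].
  have ky : k < y.
    by rewrite ltnNge; apply/negP => yk; have := mem_filter (leq^~ k) y w; rewrite -/(upto k w) wk yk yw.
  rewrite upto_nil //; apply: sub_all yt => x /=; rewrite eqbF_neg -ltnNge.
  exact: ltn_trans.
have [->|t0] := eqVneq t [::]; [by left | right].
have := H (wmin t); case wE: (upto (wmin t) w) => [|y s] /=.
  have : wmin t \in upto (wmin t) t by rewrite mem_filter leqnn wmin_mem.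
  by case: upto => // ? ? _ /(_ isT).
have : y \in upto (wmin t) w by rewrite wE mem_head.
rewrite mem_filter => /andP[ymin yw] _; apply/hasP; exists y => //.
apply/allP => x xt; rewrite eqbF_neg -ltnNge ltn_neqAle.
rewrite (leq_trans ymin (wmin_le xt)) andbT.
by apply: contraTneq xt => <-; apply: dis.
Qed.

Lemma upto_split k t m w : m <= k ->
  upto k (t ++ m :: w) = upto k t ++ m :: upto k w.
Proof. by move=> mk; rewrite /upto filter_cat /= mk. Qed.

Lemma upto_rcons k w z : z <= k -> upto k (rcons w z) = rcons (upto k w) z.
Proof. by move=> zk; rewrite /upto filter_rcons zk. Qed.

(** Appending [z] below all letters turns a final descent of a restriction into a double descent. In
    [t ++ m :: w] the letter [m] plays this part for [t], and [z] for [w]. A double descent centred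
    at [m] arises exactly when the restriction of [w] is empty and that of [t] is not, which is what
    [right_wins_upto] excludes. *)
Lemma andreII_hdd z w : uniq w -> all (ltn z) w ->
  reflect (forall k, ~~ hdd (upto k (rcons w z))) (andre false w).
Proof.
elim/min_split_ind: w z => [|t m w mt mw IHt IHw] z; rewrite ?cat_uniq /= ?negb_or.
  by move=> _ _; apply: ReflectT => k /=; case: ifP.
move=> /and3P[ut /andP[_ dis] /andP[mNw uw]]; rewrite all_cat /= => /and3P[zt zm zw].
have utw : uniq (t ++ w) by rewrite cat_uniq ut dis.
have mw' : all (ltn m) w.
  by apply/allP => x xw; rewrite /= ltn_neqAle (allP mw) // andbT; apply: contraNneq mNw => ->.
have zmw k : m <= k -> hdd (upto k (rcons (t ++ m :: w) z)) =
   [|| hdd (upto k (rcons t m)), hdd (upto k (rcons w z))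
     | nilp (upto k w) && ~~ nilp (upto k t)].
  move=> mk; rewrite rcons_cat /= upto_split // upto_rcons ?(leq_trans (ltnW zm)) //.
  by rewrite hdd_split_rcons ?all_upto // -upto_rcons.
(* A threshold below [m] keeps at most the closing letter [z], so only [k >= m] carries
   information. *)
have small k : k < m -> upto k (rcons t m) = [::] /\ upto k (rcons w z) = upto k [:: z].
  move=> km; split.
    by rewrite upto_nil // all_rcons /= km /=; apply: sub_all mt => x /=; apply: ltn_trans.
  rewrite -cats1 /upto filter_cat -/(upto k w) upto_nil //.
  by apply: sub_all mw => x /=; apply: leq_trans.
have hdd1 k : hdd (upto k [:: z]) = false by rewrite /=; case: ifP.
rewrite andreE //; apply: (iffP and3P) =>
  [[/(IHt _ ut mt) Ht /(IHw _ uw zw) Hw /(right_wins_upto utw) Htw] k|H].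
  have [mk|km] := leqP m k.
    rewrite zmw // (negPf (Ht k)) (negPf (Hw k)) /=.
    by apply/negP => /andP[/Htw ->].
  rewrite -cats1 /upto !filter_cat /= leqNgt km /= -/(upto k t) -/(upto k w) !upto_nil /=; first by case: ifP.
    by apply: sub_all mw => x /=; apply: leq_trans.
  by apply: sub_all mt => x /=; apply: ltn_trans.
split.
- apply/(IHt _ ut mt) => k; have [mk|/small[->]//] := leqP m k.
  by have := H k; rewrite zmw // !negb_or => /and3P[].
- apply/(IHw _ uw zw) => k; have [mk|/small[_ ->]] := leqP m k; last by rewrite hdd1.
  by have := H k; rewrite zmw // !negb_or => /and3P[].
apply/(right_wins_upto utw) => k; have [mk|km] := leqP m k.
  by have := H k; rewrite zmw // !negb_or negb_and negbK => /and3P[_ _ /orP[/negPf->|]].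
by move=> _; rewrite upto_nil //; apply: sub_all mt => x /=; apply: ltn_trans.
Qed.

(** Letters after [m] are at least [m], so no double descent is centred at [m]. What remains is the
    condition of [andreII_hdd] on [t], with [m] as closing letter, and the same condition on [w]. *)
Lemma chainII_hdd w : uniq w ->
  reflect (forall k, ~~ hdd (upto k w)) (chain false w).
Proof.
elim/min_split_ind: w => [|t m w mt mw _ IHw]; first by move=> _; apply: ReflectT.
rewrite ?cat_uniq /= => /and3P[ut _ /andP[_ uw]].
rewrite chainE //; apply: (iffP andP) => [[/(andreII_hdd ut mt) Ht /(IHw uw) Hw] k|H].
  have [mk|km] := leqP m k.
    rewrite upto_split // hdd_split ?all_upto // -upto_rcons //.
    by rewrite negb_or Ht Hw.
  rewrite upto_nil // all_cat /= km; apply/andP; split.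
    by apply: sub_all mt => x /=; apply: ltn_trans.
  by apply: sub_all mw => x /=; apply: leq_trans.
have {}H k : m <= k -> ~~ hdd (upto k (rcons t m)) && ~~ hdd (upto k w).
  move=> mk; have := H k; rewrite upto_split // hdd_split ?all_upto //.
  by rewrite -upto_rcons // negb_or.
split.
  apply/(andreII_hdd ut mt) => k; have [/H/andP[]//|km] := leqP m k.
  by rewrite upto_nil // all_rcons /= km /=; apply: sub_all mt => x /=; apply: ltn_trans.
apply/(IHw uw) => k; have [/H/andP[]//|km] := leqP m k.
by rewrite upto_nil //; apply: sub_all mw => x /=; apply: leq_trans.
Qed.

(** The characterisation of simsun permutations by chains, taken as the definition for words with
    repeated letters. *)
Definition simsun_word u :=
  all (geq (last 0 u)) u && chain false (take (size u).-1 u).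

Lemma simsun_word_rcons w x :
  simsun_word (rcons w x) = all (geq x) w && chain false w.
Proof.
by rewrite /simsun_word last_rcons size_rcons /= -cats1 take_size_cat // all_cat /= leqnn !andbT.
Qed.

Lemma simsun_word_map f u : pairwise (keeps_order f) u ->
  simsun_word (map f u) = simsun_word u.
Proof.
case/lastP: u => // w x; rewrite map_rcons !simsun_word_rcons -cats1 pairwise_cat.
rewrite allrel1r => /and3P[wx pw _]; rewrite chain_map // all_map.
by congr (_ && _); apply: eq_in_all => y yw; apply: (eqP (allP wx y yw)).
Qed.

Lemma simsun_permE n u : 0 < n -> u \in perms n -> simsun n u = simsun_word u.
Proof.
move=> n0; rewrite mem_permutations => pu.
have uu : uniq u by rewrite (perm_uniq pu) iota_uniq.
have uE x : (x \in u) = (0 < x <= n) by rewrite (perm_mem pu) mem_iota add1n ltnS.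
case/lastP: u {pu} uu uE => [|w x] uu uE.
  by have := uE n; rewrite n0 leqnn.
rewrite /simsun last_rcons simsun_word_rcons.
have xn : x <= n by have := uE x; rewrite mem_rcons mem_head => /esym/andP[].
have -> : all (geq x) w = (x == n).
  apply/allP/eqP => [H|-> y yw].
    apply/eqP; rewrite eqn_leq xn /=; have := uE n.
    rewrite n0 leqnn mem_rcons in_cons => /predU1P[->//|]; exact: H.
  by have := uE y; rewrite mem_rcons in_cons yw orbT => /esym/andP[].
case: eqP => // xE; subst x; rewrite /=.
have uw : uniq w by move: uu; rewrite rcons_uniq => /andP[].
have wn : all (geq n) w.
  by apply/allP => y yw; have := uE y; rewrite mem_rcons in_cons yw orbT => /esym/andP[].
have E k : hdd (upto k (rcons w n)) = hdd (upto k w).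
  rewrite /upto filter_rcons; case: ifP => // _.
  by rewrite hdd_rcons_ge //; apply: all_upto.
apply/allP/(chainII_hdd uw) => H k; last by rewrite -/(upto k _) E.
(* [simsun] tests only the thresholds from 1 to [n]: threshold 0 keeps nothing, and those above [n]
   keep everything. *)
have [->|k0] := posnP k.
  rewrite upto_nil //; apply/allP => y yw; have := uE y.
  by rewrite mem_rcons in_cons yw orbT => /esym/andP[].
have -> : upto k w = upto (minn k n) w.
  apply: eq_in_filter => y yw; rewrite leq_min.
  by have /= -> := allP wn y yw; rewrite andbT.
by rewrite -E; apply: H; rewrite mem_iota; lia.
Qed.

(** * Generating functions of words *)

Fixpoint words l m n : seq (seq nat) :=
  if n is n'.+1 then [seq x :: w | x <- iota l m, w <- words l m n']
  else [:: [::]].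

Lemma mem_words l m n w :
  (w \in words l m n) = (size w == n) && all (fun x => l <= x < l + m) w.
Proof.
elim: n w => [|n IHn] w /=; first by rewrite inE; case: w.
apply/allpairsP/idP => [[[x v] /= [xi vw ->]]|].
  by move: vw xi; rewrite IHn mem_iota /= eqSS => /andP[-> ->] ->.
case: w => // x v /= /andP[sv /andP[xlm vlm]]; exists (x, v).
by rewrite mem_iota IHn -eqSS sv.
Qed.

Lemma words_uniq l m n : uniq (words l m n).
Proof.
elim: n => //= n IHn; apply: allpairs_uniq => //; first exact: iota_uniq.
by move=> [x v] [y w] _ _ [-> ->].
Qed.

Local Open Scope ring_scope.

Lemma sum_words_cons (R : comNzRingType) l m n (F : seq nat -> R) :
  \sum_(w <- words l m n.+1) F w =
  \sum_(x <- iota l m) \sum_(w <- words l m n) F (x :: w).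
Proof. by rewrite /= big_allpairs_dep. Qed.

Arguments words : simpl never.

Lemma sum_words_first_min (R : comNzRingType) l m n (F : seq nat -> R) :
  \sum_(w <- words l m.+1 n) F w =
  \sum_(w <- words l.+1 m n) F w +
  \sum_(i < n) \sum_(t <- words l.+1 m i)
     \sum_(w <- words l m.+1 (n - i.+1)) F (t ++ l :: w).
Proof.
elim: n F => [|n IHn] F; first by rewrite big_ord0 addr0.
rewrite !sum_words_cons /= big_cons.
under [X in _ + X = _]eq_bigr => x _ do rewrite IHn.
rewrite big_split /= addrCA; congr (_ + _).
rewrite big_ord_recl big_seq1 subSS subn0; congr (_ + _).
rewrite exchange_big; apply: eq_bigr => i _.
by rewrite sum_words_cons /= subSS.
Qed.

(** [j] is the number of letters above the leftmost minimum, which is therefore [l + m - j.+1]: [t]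
    uses these [j] letters, while [w] may also repeat the minimum. *)
Lemma sum_words_split (R : comNzRingType) l m n (F : seq nat -> R) :
  \sum_(w <- words l m n) F w =
  (n == 0%N)%:R * F [::] +
  \sum_(j < m) \sum_(i < n) \sum_(t <- words (l + m - j) j i)
     \sum_(w <- words (l + m - j.+1) j.+1 (n - i.+1)) F (t ++ (l + m - j.+1)%N :: w).
Proof.
elim: m l => [|m IHm] l.
  rewrite big_ord0 addr0; case: n => [|n]; first by rewrite big_seq1 mul1r.
  by rewrite sum_words_cons /= big_nil mul0r.
rewrite sum_words_first_min IHm -addrA big_ord_recr /=; congr (_ + _).
by rewrite addSnnS (_ : l + m.+1 - m = l.+1)%N ?addnK //; lia.
Qed.

Lemma sum_words_last_max (R : comNzRingType) l m n (F : seq nat -> R) :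
  \sum_(w <- words l m n.+1 | all (geq (last 0%N w)) w) F w =
  \sum_(k < m) \sum_(w <- words l k.+1 n) F (rcons w (l + k)%N).
Proof.
pose G w x := if all (geq x) w then F (rcons w x) else 0.
have wordsE : \sum_(w <- words l m n.+1 | all (geq (last 0%N w)) w) F w =
   \sum_(w <- words l m n) \sum_(x <- iota l m) G w x.
  (* [words] extends at the front; listing the same words by extension at the back isolates the last
     letter. *)
  have p : perm_eq (words l m n.+1) [seq rcons w x | w <- words l m n, x <- iota l m].
    apply: uniq_perm; first exact: words_uniq.
      apply: allpairs_uniq; rewrite ?words_uniq ?iota_uniq //.
      by move=> [v x] [w y] _ _ /= /rcons_inj.
    move=> w; apply/idP/allpairsP => [|[[v x] [vw xi ->]]].
      case/lastP: w => [|w x]; rewrite mem_words // size_rcons eqSS all_rcons.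
      case/and3P=> sw xlm wlm; exists (w, x).
      by rewrite mem_words mem_iota sw wlm.
    rewrite mem_words; move: vw; rewrite mem_words.
    rewrite size_rcons eqSS all_rcons => /andP[-> ->].
    by rewrite mem_iota in xi; rewrite xi.
  rewrite (perm_big _ p) big_mkcond big_allpairs_dep.
  apply: eq_bigr => w _; apply: eq_bigr => x _.
  by rewrite last_rcons all_rcons /= leqnn.
rewrite wordsE exchange_big -[l in iota l]addn0 iotaDl big_map.
rewrite -[X in iota _ X]subn0 -/(index_iota 0 m) big_mkord; apply: eq_bigr => k _.
transitivity (\sum_(w <- words l m n | all (geq (l + k)%N) w) F (rcons w (l + k)%N)).
  by rewrite [RHS]big_mkcond.
rewrite -big_filter; apply: perm_big; apply: uniq_perm.
- by rewrite filter_uniq ?words_uniq.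
- exact: words_uniq.
move=> w; rewrite mem_filter !mem_words andbCA; congr (_ && _).
rewrite -all_predI; apply: eq_all => x /=; have := ltn_ord k; lia.
Qed.

Lemma words_gt (R : comNzRingType) l l' m m' n (F : seq nat -> R) :
  (l <= l')%N -> (l + m = l' + m')%N ->
  \sum_(w <- words l m n | all (leq l') w) F w = \sum_(w <- words l' m' n) F w.
Proof.
move=> ll' e; rewrite -big_filter; apply: perm_big; apply: uniq_perm.
- by rewrite filter_uniq ?words_uniq.
- exact: words_uniq.
move=> w; rewrite mem_filter !mem_words andbCA; congr (_ && _).
rewrite -all_predI; apply: eq_all => x /=; lia.
Qed.

(** For independent [x] this records the whole descent set; [p] is the position of the first letter,
    so right factors keep their absolute positions. *)
Fixpoint desprod (R : comNzRingType) (x : nat -> R) p w : R :=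
  if w is y :: w' then
    (if w' is z :: _ then (if (z < y)%N then x p else 1) else 1)
      * desprod x p.+1 w'
  else 1.

(* Weight of the descent from the last letter of [t] to a smaller letter after it;
   the position of [t] starts at [p]. *)
Definition link (R : comNzRingType) (x : nat -> R) p (t : seq nat) : R :=
  if nilp t then 1 else x (p + (size t).-1)%N.

Lemma desprod_cons_le (R : comNzRingType) (x : nat -> R) p l w :
  all (leq l) w -> desprod x p (l :: w) = desprod x p.+1 w.
Proof. by case: w => [|y w] /=; rewrite ?mul1r // ltnNge => /andP[-> _]; rewrite mul1r. Qed.

(** The minimum is entered by a descent unless [t] is empty, and is never left by one. *)
Lemma desprod_split (R : comNzRingType) (x : nat -> R) p t l w :
  all (ltn l) t -> all (leq l) w ->
  desprod x p (t ++ l :: w) =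
  desprod x p t * link x p t * desprod x (p + (size t).+1) w.
Proof.
move=> lt lw; elim: t p lt => [|y t IHt] p.
  by rewrite cat0s desprod_cons_le // addn1 /= !mul1r.
move=> /= /andP[ly /[dup] lt /IHt ->]; rewrite addSnnS.
case: t {IHt} lt => [|z t] /=; first by rewrite /link /= ly !addn0 !mul1r ?mulr1 ?mulrA.
by rewrite /link /= !mulrA addSnnS.
Qed.

Lemma desprod_rcons (R : comNzRingType) (x : nat -> R) p w y :
  all (geq y) w -> desprod x p (rcons w y) = desprod x p w.
Proof.
elim: w p => [|z [|z' w] IHw] p /=; first by rewrite mulr1.
  by rewrite andbT ltnNge => -> /=; rewrite mul1r.
by move=> /andP[_ h]; have /= -> := IHw p.+1 h.
Qed.

(* [esol m p n] solves the recursion, over alphabets of [m] letters and from position [p] on,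
   common to chains of length [n] and to André II words of length [n.+1] that contain the
   smallest letter; [efac] is the contribution of a possibly empty André factor of length [i]
   over [j] letters followed by a smaller letter. *)
Definition efac (R : comNzRingType) (x : nat -> R) (e : nat -> nat -> nat -> R) j p i : R :=
  if i is i'.+1 then x (p + i')%N * \sum_(k < j) e k.+1 p i' else 1.

Lemma eq_efac (R : comNzRingType) (x : nat -> R) e e' j p i :
  (forall k i', (i' < i)%N -> e k p i' = e' k p i') ->
  efac x e j p i = efac x e' j p i.
Proof.
case: i => //= i E; congr (_ * _); apply: eq_bigr => k _.
by rewrite E.
Qed.

Fixpoint esol_rec (R : comNzRingType) (x : nat -> R) (h m p n : nat) : R :=
  if h is h'.+1 then
    (n == 0%N)%:R + \sum_(j < m) \sum_(i < n)
       efac x (esol_rec x h') j p i * esol_rec x h' j.+1 (p + i.+1)%N (n - i.+1)%N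
  else 0.
Definition esol (R : comNzRingType) (x : nat -> R) m p n := esol_rec x n.+1 m p n.

Lemma esol_rec_fuel (R : comNzRingType) (x : nat -> R) h m p n :
  (n < h)%N -> esol_rec x h m p n = esol x m p n.
Proof.
rewrite /esol; have [N] := ubnP n; elim: N n h m p => // N IHN n [|h] m p // nN nh.
rewrite /=; congr (_ + _); apply: eq_bigr => j _; apply: eq_bigr => i _.
have iN := ltn_ord i; congr (_ * _); last by rewrite IHN 1?[RHS]IHN //; lia.
by apply: eq_efac => k i' i'i; rewrite IHN 1?[RHS]IHN //; lia.
Qed.

Lemma esolE (R : comNzRingType) (x : nat -> R) m p n :
  esol x m p n = (n == 0%N)%:R + \sum_(j < m) \sum_(i < n)
       efac x (esol x) j p i * esol x j.+1 (p + i.+1)%N (n - i.+1)%N.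
Proof.
rewrite {1}/esol /=; congr (_ + _); apply: eq_bigr => j _; apply: eq_bigr => i _.
have iN := ltn_ord i; congr (_ * _); last by rewrite esol_rec_fuel //; lia.
by apply: eq_efac => k i' i'i; rewrite esol_rec_fuel //; lia.
Qed.

(** * The common recursion for the three classes of words *)

Definition andre_sum (R : comNzRingType) (x : nat -> R) b l m p n :=
  \sum_(w <- words l m n | andre b w) desprod x p w.
Definition chain_sum (R : comNzRingType) (x : nat -> R) b l m p n :=
  \sum_(w <- words l m n | chain b w) desprod x p w.

Lemma words_all l m n w : w \in words l m n -> all (leq l) w.
Proof. by rewrite mem_words => /andP[_]; apply: sub_all => x /andP[]. Qed.

Lemma words_size l m n w : w \in words l m n -> size w = n.
Proof. by rewrite mem_words => /andP[/eqP]. Qed.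

Lemma efac_sum (R : comNzRingType) (x : nat -> R) b l j p i :
  ((0 < i)%N -> andre_sum x b l j p i = \sum_(k < j) esol x k.+1 p i.-1) ->
  \sum_(t <- words l j i | andre b t) desprod x p t * link x p t = efac x (esol x) j p i.
Proof.
case: i => [_|i /(_ isT) /= E]; first by rewrite big_mkcond big_seq1 /link /= mul1r.
rewrite /= -E mulr_sumr big_seq_cond [RHS]big_seq_cond.
apply: eq_bigr => t /andP[/words_size st _].
by rewrite /link /nilp st /= mulrC.
Qed.

(** Splitting at the leftmost minimum reproduces [esolE], since no condition links the two factors
    of a chain. The bound [N] allows the hypothesis to be an induction hypothesis still in
    progress. *)
Lemma chain_sum_esol (R : comNzRingType) (x : nat -> R) b N :
  (forall l m p n, (n < N)%N ->
     andre_sum x b l m p n.+1 = \sum_(k < m) esol x k.+1 p n) ->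
  forall l m p n, (n <= N)%N -> chain_sum x b l m p n = esol x m p n.
Proof.
move=> HA l m p n; elim/ltn_ind: n l m p => n IHn l m p nN.
rewrite esolE /chain_sum big_mkcond sum_words_split mulr1; congr (_ + _).
apply: eq_bigr => j _; apply: eq_bigr => i _.
have [iN jN] := (ltn_ord i, ltn_ord j).
rewrite -(@efac_sum _ _ b (l + m - j)); last first.
  by move=> i0; rewrite -[X in andre_sum _ _ _ _ _ X](prednK i0) HA //; lia.
rewrite -(IHn (n - i.+1)%N _ (l + m - j.+1)%N); [|lia|lia].
rewrite mulr_suml [RHS]big_mkcond big_seq [RHS]big_seq; apply: eq_bigr => t tw.
have lt : all (ltn (l + m - j.+1)%N) t.
  by apply: sub_all (words_all tw) => y /=; lia.
case: ifP => At; last first.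
  rewrite big_seq big1 // => w /words_all lw.
  by rewrite chainE // At.
rewrite mulr_sumr [RHS]big_mkcond big_seq [RHS]big_seq; apply: eq_bigr => w /words_all lw.
rewrite chainE // At /= desprod_split // (words_size tw).
by [].
Qed.

(** By [andre_rcons] these are chains of length [n] followed by a bounding letter, which adds no
    descent. The factors of the chain are shorter André I words, whence the strong induction. *)
Lemma andreI_sum_esol (R : comNzRingType) (x : nat -> R) l m p n :
  andre_sum x true l m p n.+1 = \sum_(k < m) esol x k.+1 p n.
Proof.
have [N] := ubnP n; elim: N n l m p => // N IHN n l m p nN.
transitivity (\sum_(k < m) chain_sum x true l k.+1 p n); last first.
  by apply: eq_bigr => k _; apply: (@chain_sum_esol _ _ _ N) => // *; apply: IHN.
pose F w := if andre true w then desprod x p w else 0.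
transitivity (\sum_(w <- words l m n.+1 | all (geq (last 0%N w)) w) F w).
  rewrite /andre_sum [RHS]big_mkcond [LHS]big_mkcond; apply: eq_bigr => w _; rewrite /F.
  case/lastP: w => // w y; rewrite last_rcons andre_rcons all_rcons /= leqnn /=.
  by case: (all (geq y) w).
rewrite sum_words_last_max; apply: eq_bigr => k _; rewrite /chain_sum [RHS]big_mkcond.
apply: eq_big_seq => w; rewrite mem_words => /andP[_ aw]; rewrite /F.
have wk : all (geq (l + k)%N) w by apply: sub_all aw => y /=; lia.
by rewrite andre_rcons wk desprod_rcons.
Qed.

(* André II words of length [n.+1] over [k.+1] letters, the smallest of which, [l], occurs. *)
Definition andreII_min_sum (R : comNzRingType) (x : nat -> R) l k p n :=
  \sum_(i < n.+1) \sum_(t <- words l.+1 k i) \sum_(w <- words l k.+1 (n - i))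
     if andre false (t ++ l :: w) then desprod x p (t ++ l :: w) else 0.

Lemma andreII_sum_min (R : comNzRingType) (x : nat -> R) l m p n :
  andre_sum x false l m p n.+1 =
  \sum_(k < m) andreII_min_sum x (l + m - k.+1) k p n.
Proof.
rewrite /andre_sum big_mkcond sum_words_split mul0r add0r.
apply: eq_bigr => k _; apply: eq_bigr => i _; rewrite subSS.
by rewrite (_ : (l + m - k.+1).+1 = l + m - k)%N //; have := ltn_ord k; lia.
Qed.

Lemma right_wins_min t s mu v : all (ltn mu) s -> all (leq mu) v ->
  right_wins false t (s ++ mu :: v) = all (ltn mu) t.
Proof.
move=> ms mv; apply/orP/idP => [[/nilP -> //|/hasP[y yv]]|mt].
  apply: sub_all => z; rewrite eqbF_neg -ltnNge; apply: leq_ltn_trans.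
  by rewrite -(wmin_split ms mv) wmin_le.
right; apply/hasP; exists mu; first by rewrite mem_cat mem_head orbT.
by apply: sub_all mt => z; rewrite eqbF_neg -ltnNge.
Qed.

(** Split the part after [l] at its own minimum [mu]. By [right_wins_min] the word is André II
    exactly when both parts are and [t] lies above [mu]. So [mu] determines the alphabet of [t], as
    the minimum after [t] does in a chain, and the right part is counted by the same sum with [mu]
    for [l]. *)
Lemma andreII_min_sum_esol (R : comNzRingType) (x : nat -> R) l k p n :
  andreII_min_sum x l k p n = esol x k.+1 p n.
Proof.
elim/ltn_ind: n l k p => n IHn l k p.
(* The factor [t] has length at most [n], so the induction hypothesis covers it. *)
have HA i l' m' p' : (0 < i <= n)%N ->
    andre_sum x false l' m' p' i = \sum_(h < m') esol x h.+1 p' i.-1.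
  case: i => // i /= i_n; rewrite andreII_sum_min; apply: eq_bigr => h _.
  exact: IHn.
rewrite esolE /andreII_min_sum big_ord_recr /= addrC; congr (_ + _).
  (* For [i = n] nothing follows [l], so [right_wins] forces [t] to be empty, that is [n = 0]. *)
  rewrite subnn big_seq; case: (n) => [|n'].
    by rewrite -big_seq !big_seq1 (@andreE _ [::]) //= !mulr1.
  rewrite big1 // => t tw; rewrite big_seq1 andreE //; last exact: words_all tw.
  by rewrite /right_wins /nilp (words_size tw) /= !andbF.
rewrite exchange_big /=; apply: eq_bigr => i _; have iN := ltn_ord i.
under eq_bigr => t _.
  rewrite -(subnSK iN) sum_words_split mul0r add0r; over.
rewrite exchange_big /=; apply: eq_bigr => j _; have jk := ltn_ord j.
set mu := (l + k.+1 - j.+1)%N.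
rewrite -(IHn (n - i.+1)%N _ mu); last by lia.
rewrite -(@efac_sum _ _ false mu.+1); last by move=> i0; rewrite HA ?i0 // ltnW.
pose f t := desprod x p t * link x p t.
transitivity ((\sum_(t <- words l.+1 k i | all (leq mu.+1) t)
    if andre false t then f t else 0) * andreII_min_sum x mu j (p + i.+1) (n - i.+1)).
  rewrite mulr_suml [RHS]big_mkcond /=.
  rewrite big_seq [RHS]big_seq; apply: eq_bigr => t tw.
  rewrite -[RHS]/(if all (ltn mu) t then _ else _).
  transitivity ((if all (ltn mu) t && andre false t then f t else 0) *
       andreII_min_sum x mu j (p + i.+1) (n - i.+1)); last first.
    by case: (all _ t); rewrite ?mul0r.
  rewrite /andreII_min_sum mulr_sumr; apply: eq_bigr => i' _.
  rewrite (_ : l + k.+1 - j = mu.+1)%N; last by rewrite /mu; lia.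
  rewrite mulr_sumr big_seq [RHS]big_seq; apply: eq_bigr => s sw.
  rewrite subSS mulr_sumr big_seq [RHS]big_seq; apply: eq_bigr => v vw.
  have [lt ms mv] := And3 (words_all tw) (words_all sw) (words_all vw).
  have lmu : (l <= mu)%N by rewrite /mu; lia.
  have lsv : all (leq l) (s ++ mu :: v).
    rewrite all_cat /= lmu; apply/andP; split.
      by apply: sub_all ms => z /=; lia.
    by apply: sub_all mv => z /=; lia.
  rewrite andreE // right_wins_min // desprod_split // (words_size tw).
  rewrite [X in if X then _ else 0](_ : _ =
    (all (ltn mu) t && andre false t) && andre false (s ++ mu :: v)).
    by case: (_ && andre _ t); case: (andre _ (s ++ _)); rewrite ?mul0r ?mulr0.
  by case: (andre false t); case: (all (ltn mu) t); rewrite /= ?andbF ?andbT.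
(* Exactly [j] letters of the alphabet exceed [mu]. *)
rewrite (@words_gt _ _ mu.+1 _ j) -?big_mkcond //; rewrite /mu; lia.
Qed.

Lemma andreII_sum_esol (R : comNzRingType) (x : nat -> R) l m p n :
  andre_sum x false l m p n.+1 = \sum_(k < m) esol x k.+1 p n.
Proof.
rewrite andreII_sum_min; apply: eq_bigr => k _.
exact: andreII_min_sum_esol.
Qed.

Lemma simsun_sum_esol (R : comNzRingType) (x : nat -> R) l m p n :
  \sum_(w <- words l m n.+1 | simsun_word w) desprod x p w
    = \sum_(k < m) esol x k.+1 p n.
Proof.
transitivity (\sum_(k < m) chain_sum x false l k.+1 p n); last first.
  by apply: eq_bigr => k _; apply: (@chain_sum_esol _ _ _ n) => // *; apply: andreII_sum_esol.
pose F w := if simsun_word w then desprod x p w else 0.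
transitivity (\sum_(w <- words l m n.+1 | all (geq (last 0%N w)) w) F w).
  rewrite [RHS]big_mkcond [LHS]big_mkcond; apply: eq_bigr => w _; rewrite /F.
  by rewrite /simsun_word; case: (all _ w).
rewrite sum_words_last_max; apply: eq_bigr => k _; rewrite /chain_sum [RHS]big_mkcond.
apply: eq_big_seq => w; rewrite mem_words => /andP[_ aw]; rewrite /F.
have wk : all (geq (l + k)%N) w by apply: sub_all aw => y /=; lia.
by rewrite simsun_word_rcons wk desprod_rcons.
Qed.

(** * Standardisation *)

Local Open Scope nat_scope.

Lemma Des_cons y z w :
  Des [:: y, z & w] = nseq (z < y) 1 ++ map succn (Des (z :: w)).
Proof.
have -> : map succn (Des (z :: w)) =
    [seq i <- iota 2 (size w) | nth 0 [:: y, z & w] i.-1 > nth 0 [:: y, z & w] i].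
  rewrite (iotaDl 1 1) filter_map; congr map.
  by apply: eq_in_filter => i; rewrite mem_iota => /andP[i0 _]; rewrite /= -(prednK i0).
by rewrite /Des /=; case: ifP.
Qed.

Lemma des_cons y z w : des [:: y, z & w] = (z < y) + des (z :: w).
Proof. by rewrite /des Des_cons size_cat size_nseq size_map. Qed.

Lemma maj_cons y z w :
  maj [:: y, z & w] = (z < y) + maj (z :: w) + des (z :: w).
Proof.
rewrite /maj /des Des_cons sumn_cat sumn_nseq mul1n -addnA; congr (_ + _).
by elim: (Des _) => //= i s ->; lia.
Qed.

Lemma des_le w : des w <= size w.
Proof. by rewrite /des size_filter (leq_trans (count_size _ _)) // size_iota leq_pred. Qed.

(** * Counting the words with a given standardisation *)

Definition lexle (a b : nat * nat) :=
  (a.1 < b.1) || (a.1 == b.1) && (a.2 <= b.2).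

Lemma lexle_trans : transitive lexle.
Proof. by move=> [b b'] [a a'] [c c']; rewrite /lexle /=; lia. Qed.

Lemma lexle_total : total lexle.
Proof. by move=> [a a'] [b b']; rewrite /lexle /=; lia. Qed.

(** Iterated Pascal's rule; truncated subtraction makes the terms with [m - j <= e] vanish. *)
Lemma hockey_stick m e a :
  \sum_(j < m) 'C(m - j - e + a, a.+1) = 'C(m - e + a.+1, a.+2).
Proof.
elim: m => [|m IHm]; first by rewrite big_ord0 bin_small // sub0n.
rewrite big_ord_recl subn0.
under eq_bigr => i _ do rewrite lift0 subSS.
rewrite {}IHm; have [em|me] := leqP e m.
  by rewrite subSn // addSnnS [in RHS]addSn binS addnC.
have [-> ->] : m.+1 - e = 0 /\ m - e = 0 by lia.
by rewrite !add0n !bin_small.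
Qed.

Lemma size_words l m n : size (words l m n) = m ^ n.
Proof. by elim: n => // n IHn; rewrite [LHS]size_allpairs IHn size_iota expnS. Qed.

Lemma sorted_lex_all c pi : size c = size pi -> sorted lexle (zip c pi) ->
  all (leq (head 0 c)) c.
Proof.
case: c pi => [|a c] [|i pi] //= [sz]; rewrite leqnn /=.
rewrite (path_sortedE lexle_trans) => /andP[/allP H _].
apply/(all_nthP 0) => k kc; have := H (nth (0, 0) (zip c pi) k).
rewrite mem_nth ?size_zip -?sz ?minnn // nth_zip // /lexle /= => /(_ isT).
by case: ltngtP.
Qed.

(** Such [c] increase weakly, and strictly at the descents of [x :: pi]. If the first value is
    [l + j], the others start at [l + j + (y < x)]; [hockey_stick] sums over [j]. *)
Lemma count_sorted_lex l m x pi :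
  count (fun c => sorted lexle (zip c (x :: pi))) (words l m (size pi).+1) =
  'C(m - des (x :: pi) + size pi, (size pi).+1).
Proof.
elim: pi x l m => [|y pi IHpi] x l m.
  rewrite /= addn0 subn0 bin1.
  rewrite (@eq_in_count _ _ predT); last by move=> [|a [|b c]] /words_size.
  by rewrite count_predT size_words expn1.
rewrite des_cons /= -hockey_stick.
have -> : words l m (size pi).+2 = [seq v :: w | v <- iota l m, w <- words l m (size pi).+1] by [].
rewrite count_flatten -map_comp sumnE big_map -[l in iota l]addn0 iotaDl big_map.
rewrite -[X in iota _ X]subn0 -/(index_iota 0 m) big_mkord; apply: eq_bigr => j _.
rewrite subnDA [LHS]count_map -(IHpi y (l + j + (y < x)) (m - j - (y < x))).
rewrite -!size_filter; apply/perm_size/uniq_perm.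
- by rewrite filter_uniq ?words_uniq.
- by rewrite filter_uniq ?words_uniq.
have jm := ltn_ord j.
move=> c; rewrite !mem_filter !mem_words /=.
case: c => [|a c]; first by rewrite !andbF.
rewrite /= eqSS; case: eqP => [sz|]; last by rewrite !andbF.
have [sc|] := boolP (path lexle (a, y) (zip c pi)); last by rewrite !andbF.
(* The tail increases weakly, so a lower bound need only be checked at its first value. *)
have /= := @sorted_lex_all (a :: c) (y :: pi); rewrite sz leqnn /= => /(_ erefl sc) ac.
rewrite andbT /lexle /=; apply/idP/idP.
  move=> /and3P[ja lam lcm]; apply/andP; split; first by move: ja lam; lia.
  apply/allP => b bc; have := allP ac b bc; have := allP lcm b bc.
  by move: ja lam; lia.
move=> /andP[jam lcm]; apply/and3P; split; [by move: jam; lia..|].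
by apply: sub_all lcm => b; lia.
Qed.

Definition letter (c : seq nat) x := nth 0 c x.-1.

Lemma perms_facts n s : s \in perms n ->
  [/\ uniq s, size s = n & forall x, (x \in s) = (0 < x <= n)].
Proof.
rewrite mem_permutations => ps; split; first by rewrite (perm_uniq ps) iota_uniq.
  by rewrite (perm_size ps) size_iota.
by move=> x; rewrite (perm_mem ps) mem_iota add1n ltnS.
Qed.

Lemma nth_inv_word n s k : size s = n -> k < n -> nth 0 (inv_word s) k = (index k.+1 s).+1.
Proof. by move=> sn kn; rewrite (nth_map 0) ?size_iota ?sn // nth_iota. Qed.

(** It suffices to compare consecutive values [i.+1] and [i.+2]: [c] may stay constant if they occur
    in this order in [s], and must grow otherwise. Their positions are entries of [inv_word s], and
    transitivity of [lexle] gives all other pairs. *)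
Lemma keeps_order_sorted n s c : s \in perms n -> size c = n ->
  pairwise (keeps_order (letter c)) s = sorted lexle (zip c (inv_word s)).
Proof.
move=> /perms_facts[us sn sE] cn.
have invn : size (inv_word s) = n by rewrite size_map size_iota.
have zn : size (zip c (inv_word s)) = n by rewrite size_zip cn invn minnn.
have nz k : k < n -> nth (0, 0) (zip c (inv_word s)) k = (letter c k.+1, (index k.+1 s).+1).
  by move=> kn; rewrite nth_zip ?cn ?invn // (nth_inv_word sn).
apply/(pairwiseP 0)/(sortedP (0, 0)) => [H i|H p q].
  rewrite zn => i1n; rewrite !nz //; last by lia.
  have [is1 is2] : i.+1 \in s /\ i.+2 \in s by rewrite !sE; lia.
  have := H (index i.+1 s) (index i.+2 s); have := H (index i.+2 s) (index i.+1 s).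
  rewrite !inE !index_mem is1 is2 !nth_index // => /(_ isT isT) H1 /(_ isT isT) H2.
  rewrite /lexle /=; case: (ltngtP (index i.+1 s) (index i.+2 s)) => [lt|gt|e].
  - by have /eqP := H2 lt; lia.
  - by have /eqP := H1 gt; lia.
  have : nth 0 s (index i.+1 s) = nth 0 s (index i.+2 s) by rewrite e.
  by rewrite !nth_index //; lia.
rewrite !inE sn => pn qn pq; set x := nth 0 s p; set y := nth 0 s q.
have L a b : 0 < a -> a < b -> b <= n ->
    lexle (letter c a, (index a s).+1) (letter c b, (index b s).+1).
  case: a => // a _; case: b => // b; rewrite ltnS => ab bn.
  rewrite -!nz //; last by lia.
  have srt : sorted lexle (zip c (inv_word s)) by apply/(sortedP (0, 0)).
  by apply: (sorted_ltn_nth lexle_trans (0, 0) srt) => //; rewrite inE zn; lia.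
have [xs ys] : x \in s /\ y \in s by rewrite !mem_nth ?sn.
have [ix iy] : index x s = p /\ index y s = q by rewrite !index_uniq ?sn.
have xy : x <> y by move=> xy; move: pq; rewrite -ix -iy xy ltnn.
move: xs ys; rewrite !sE => /andP[x0 xn] /andP[y0 yn].
rewrite /keeps_order; case: (ltngtP x y) => // {}xy.
  by have := L _ _ x0 xy yn; rewrite /lexle /= ix iy; lia.
by have := L _ _ y0 xy xn; rewrite /lexle /= ix iy; lia.
Qed.

(** A letter of a permutation of [[n]] equals the number of letters not exceeding it. *)
Lemma perms_pattern_inj n s s' : s \in perms n -> s' \in perms n ->
  (forall p q, p < q < n ->
     (nth 0 s p <= nth 0 s q) = (nth 0 s' p <= nth 0 s' q)) ->
  s = s'.
Proof.
move=> sp s'p H.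
have rank w p : w \in perms n -> p < n ->
    nth 0 w p = \sum_(q <- iota 0 n) (nth 0 w q <= nth 0 w p).
  move=> wp pn; have [uw wn wE] := perms_facts wp.
  have : 0 < nth 0 w p <= n by rewrite -wE mem_nth ?wn.
  move: (nth 0 w p) => x /andP[x0 xn].
  have -> : \sum_(q <- iota 0 n) (nth 0 w q <= x) = count (geq x) w.
    rewrite -[in RHS](mkseq_nth 0 w) count_map wn -sum1_count [RHS]big_mkcond.
    by apply: eq_bigr => q _ /=; case: leqP.
  rewrite (permP (_ : perm_eq w (iota 1 n))) -?mem_permutations //.
  rewrite -{1}(subnKC xn) iotaD count_cat -[LHS]addn0; congr (_ + _).
    rewrite (@eq_in_count _ _ predT) ?count_predT ?size_iota // => y.
    by rewrite mem_iota /=; lia.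
  rewrite (@eq_in_count _ _ pred0) ?count_pred0 // => y.
  by rewrite mem_iota /=; lia.
have [us sn sE] := perms_facts sp; have [us' s'n s'E] := perms_facts s'p.
apply: (@eq_from_nth _ 0) => [|p]; rewrite ?sn ?s'n // => pn.
rewrite rank // [RHS]rank //; apply: eq_big_seq => q; rewrite mem_iota /= => qn.
congr nat_of_bool; case: (ltngtP q p) => [qp|pq|->]; last by rewrite !leqnn.
  by rewrite H // qp.
have neq w : uniq w -> size w = n -> nth 0 w q != nth 0 w p.
  by move=> uw wn; rewrite nth_uniq ?wn // neq_ltn pq orbT.
rewrite leq_eqVlt [RHS]leq_eqVlt (negPf (neq s us sn)) (negPf (neq s' us' s'n)) /=.
by rewrite ltnNge [RHS]ltnNge H ?pq.
Qed.

(** Sort the positions by letter, ties from left to right: [s] gives the rank of each position, and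
    [c] lists the letters in sorted order. *)
Lemma standardisation n u : size u = n ->
  exists s c, [/\ s \in perms n, perm_eq c u,
    pairwise (keeps_order (letter c)) s & u = map (letter c) s].
Proof.
move=> un; pose r : rel nat := fun i j => lexle (nth 0 u i, i) (nth 0 u j, j).
have rT : transitive r by move=> ? ? ?; apply: lexle_trans.
have rt : total r by move=> ? ?; apply: lexle_total.
pose o := sort r (iota 0 n).
have po : perm_eq o (iota 0 n) by rewrite perm_sort.
have uo : uniq o by rewrite (perm_uniq po) iota_uniq.
have on : size o = n by rewrite size_sort size_iota.
have oE p : (p \in o) = (p < n) by rewrite (perm_mem po) mem_iota.
pose s := [seq (index p o).+1 | p <- iota 0 n].
pose c := [seq nth 0 u p | p <- o].
have cE p : p < n -> letter c (index p o).+1 = nth 0 u p.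
  by move=> pn; rewrite /letter (nth_map 0) ?index_mem ?nth_index ?oE.
have sn : size s = n by rewrite size_map size_iota.
have ns p : p < n -> nth 0 s p = (index p o).+1.
  by move=> pn; rewrite (nth_map 0) ?size_iota // nth_iota.
exists s, c; split.
- have -> : perms n = permutations (map succn (iota 0 n)) by rewrite /perms (iotaDl 1 0).
  rewrite mem_permutations /s (map_comp succn); apply: perm_map.
  have oI : [seq index p o | p <- o] = iota 0 n.
    apply: (@eq_from_nth _ 0); rewrite ?size_map ?size_iota // on => i i_n.
    by rewrite nth_iota // (nth_map 0) ?on // index_uniq ?on.
  by rewrite -[X in perm_eq _ X]oI; apply: perm_map; rewrite perm_sym.
- by rewrite -[X in perm_eq _ X](mkseq_nth 0) un; apply: perm_map.
- apply/(pairwiseP 0) => p q; rewrite !inE sn => pn qn pq.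
  rewrite /keeps_order !ns // !cE // ltnS.
  have srt := sort_sorted rt (iota 0 n).
  have R a b : a < n -> b < n -> index a o < index b o -> r a b.
    by move=> an bn; apply: (sorted_ltn_index rT srt); rewrite oE.
  have ne : index p o <> index q o.
    move=> e; have : nth 0 o (index p o) = nth 0 o (index q o) by rewrite e.
    by rewrite !nth_index ?oE //; lia.
  case: (leqP (nth 0 u p) (nth 0 u q)) => up;
    case: (ltngtP (index p o) (index q o)) => // h.
    by have := R _ _ qn pn h; rewrite /r /lexle /=; lia.
  by have := R _ _ pn qn h; rewrite /r /lexle /=; lia.
apply: (@eq_from_nth _ 0); rewrite ?size_map ?size_iota // un => p pn.
by rewrite (nth_map 0) ?sn // ns // cE.
Qed.

(** Existence is [standardisation]. For uniqueness, the word determines the pattern of [s], hence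
    [s], and then [c] is read off at the positions of the values of [s]. *)
Lemma perm_words_standard m n :
  perm_eq (words 0 m n)
    [seq map (letter c) s | s <- perms n,
       c <- [seq c <- words 0 m n | pairwise (keeps_order (letter c)) s]].
Proof.
apply: uniq_perm; first exact: words_uniq.
  apply: allpairs_uniq_dep => [|s _|]; rewrite ?filter_uniq ?words_uniq ?permutations_uniq //.
  move=> [s c] [s' c'] /allpairsPdep[a [b [ap]]]; rewrite mem_filter => /andP[ka bw] [-> ->] {s c}.
  move=> /allpairsPdep[a' [b' [ap']]]; rewrite mem_filter => /andP[ka' bw'] [-> ->] {s' c'} /= e.
  have [ua an aE] := perms_facts ap; have [ua' an' aE'] := perms_facts ap'.
  have aa' : a = a'.
    apply: perms_pattern_inj ap ap' _ => p q /andP[pq qn].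
    have pn := ltn_trans pq qn.
    have K w d : size w = n -> pairwise (keeps_order (letter d)) w ->
        (letter d (nth 0 w p) <= letter d (nth 0 w q)) = (nth 0 w p <= nth 0 w q).
      by move=> wn /(pairwiseP 0) kw; apply: (eqP (kw p q _ _ _)); rewrite ?inE ?wn.
    rewrite -(K _ _ an ka) -(K _ _ an' ka').
    by rewrite -!(nth_map 0 0) ?an ?an' // e.
  subst a'; congr existT; apply: (@eq_from_nth _ 0); rewrite ?(words_size bw) ?(words_size bw') // => i i_n.
  have /(nth_index 0) ii : i.+1 \in a by rewrite aE.
  have := congr1 (fun w => nth 0 w (index i.+1 a)) e.
  have ia : index i.+1 a < size a by rewrite index_mem aE.
  by rewrite !(nth_map 0) // ii.
move=> u; apply/idP/allpairsPdep => [uw|[s [c [sp]]]].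
  have [s [c [sp cu kc uE]]] := standardisation (words_size uw).
  exists s, c; split; rewrite // mem_filter kc /=.
  by move: uw; rewrite !mem_words (perm_size cu) (perm_all _ cu).
rewrite mem_filter !mem_words => /and3P[_ /eqP cn /allP cm] ->.
have [us sn sE] := perms_facts sp; rewrite size_map sn eqxx /= all_map.
apply/allP => x; rewrite sE => xn; apply: cm; apply: mem_nth; lia.
Qed.

(** * From words back to permutations *)

Local Open Scope ring_scope.

Lemma desprod_map (R : comNzRingType) (x : nat -> R) p f w :
  pairwise (keeps_order f) w -> desprod x p (map f w) = desprod x p w.
Proof.
elim: w p => // y [|z w] IHw p // /[dup] /= /andP[/andP[yz _] _] /andP[_ kw].
by rewrite !ltnNge (eqP yz); have /= -> := IHw p.+1 kw.
Qed.

(** [P] and [desprod] are constant on the words standardising to [s], and these are counted by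
    [count_sorted_lex] with the descents of [inv_word s]. *)
Lemma sum_words_perms (R : comNzRingType) (x : nat -> R) (P : pred (seq nat)) m n p :
  (forall f w, pairwise (keeps_order f) w -> P (map f w) = P w) ->
  \sum_(u <- words 0 m n.+1 | P u) desprod x p u =
  \sum_(s <- perms n.+1 | P s) ('C(m - ides s + n, n.+1))%:R * desprod x p s.
Proof.
move=> Pmap; rewrite (perm_big _ (perm_words_standard m n.+1)) big_mkcond.
rewrite big_allpairs_dep [RHS]big_mkcond; apply: eq_big_seq => s sp.
have [us sn sE] := perms_facts sp.
transitivity (\sum_(c <- words 0 m n.+1 | sorted lexle (zip c (inv_word s)))
   if P s then desprod x p s else 0).
  rewrite big_filter big_seq_cond [RHS]big_seq_cond.
  apply: eq_big => c.
    case cw: (c \in _) => //=.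
    exact: keeps_order_sorted sp (words_size cw).
  by case/andP=> _ kc; rewrite Pmap // desprod_map.
rewrite big_const_seq iter_addr_0.
have [y [pi iE]] : exists y pi, inv_word s = y :: pi.
  by rewrite /inv_word sn /=; eexists; eexists.
have pin : size pi = n.
  by have := congr1 size iE; rewrite size_map size_iota sn /= => -[].
rewrite iE -pin count_sorted_lex /ides iE pin.
by case: (P s); rewrite ?mul0rn // mulr_natl.
Qed.

Lemma sum_by_stat (R : comNzRingType) (T : eqType) (r : seq T) (P : pred T) (d : T -> nat)
  (F : T -> R) (g : nat -> R) m :
  (forall s, s \in r -> (d s < m)%N \/ g (d s) = 0) ->
  \sum_(s <- r | P s) g (d s) * F s =
  \sum_(i < m) g i * \sum_(s <- r | P s && (d s == i)) F s.
Proof.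
move=> H; under [RHS]eq_bigr => i _ do rewrite mulr_sumr big_mkcondr.
rewrite exchange_big /= big_seq_cond [RHS]big_seq_cond.
apply: eq_bigr => s /andP[/H ds _].
have [dm|md] := ltnP (d s) m.
  by rewrite (bigD1 (Ordinal dm)) //= eqxx big1 ?addr0 // => i; rewrite eq_sym -val_eqE /= => /negPf->.
rewrite big1 => [|i _]; last by case: eqP => // di; move: (ltn_ord i); rewrite -di ltnNge md.
by case: ds => [|->]; rewrite ?mul0r // ltnNge md.
Qed.

(* The matrix of binomials indexed by [m] and the number of inverse descents is unitriangular. *)
Lemma eq_sum_stat (R : comNzRingType) (T : eqType) (r : seq T) (P Q : pred T)
  (d : T -> nat) (F : T -> R) n :
  (forall m, \sum_(s <- r | P s) ('C(m - d s + n, n.+1))%:R * F s =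
             \sum_(s <- r | Q s) ('C(m - d s + n, n.+1))%:R * F s) ->
  forall i, \sum_(s <- r | P s && (d s == i)) F s =
            \sum_(s <- r | Q s && (d s == i)) F s.
Proof.
move=> H; elim/ltn_ind => i IHi.
(* The row [m = i.+1] of the matrix: its entry is 1 at [j = i] and 0 for [j > i], while the terms
   with [j < i] cancel by induction. *)
pose g j : R := ('C(i.+1 - j + n, n.+1))%:R.
have gz s : s \in r -> (d s < i.+1)%N \/ g (d s) = 0.
  move=> _; case: (ltnP (d s) i.+1); [by left|right].
  by rewrite /g (_ : _ - _ = 0)%N ?bin_small //; lia.
have := H i.+1; rewrite !(sum_by_stat _ _ gz) !big_ord_recr /= {2 4}/g.
rewrite subSnn add1n binn !mul1r.
rewrite (eq_bigr _ (fun j _ => congr1 _ (IHi _ (ltn_ord j)))).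
exact: addrI.
Qed.

(** Starting at position [k.+1] adds [k] to every descent; the induction moves [k], and the weight
    of the theorem is the case [k = 0]. *)
Lemma desprod_stat (R : comNzRingType) (t q : R) w k :
  desprod (fun i => t * q ^+ i) k.+1 w = t ^+ des w * q ^+ (maj w + k * des w).
Proof.
elim: w k => [|y [|z w] IHw] k; first by rewrite /= muln0 mul1r.
  by rewrite /= mulr1 muln0 mul1r.
rewrite des_cons maj_cons; have /= -> := IHw k.+1.
set D := des _; set M := maj _.
case: (z < y)%N => /=.
  rewrite mulrACA -exprS -exprD add1n; congr (_ * _ ^+ _).
  by rewrite !mulSn mulnS; lia.
by rewrite mul1r !add0n; congr (_ * _ ^+ _); rewrite mulSn; lia.
Qed.

(** Letting [m] vary separates the values of [ides] through [eq_sum_stat]; the other two variables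
    enter by specialising [x]. *)
Lemma eq_stq_sum n (P Q : pred (seq nat)) :
  (forall m (R : comNzRingType) (x : nat -> R),
     \sum_(s <- perms n.+1 | P s) ('C(m - ides s + n, n.+1))%:R * desprod x 1 s =
     \sum_(s <- perms n.+1 | Q s) ('C(m - ides s + n, n.+1))%:R * desprod x 1 s) ->
  \sum_(w <- perms n.+1 | P w) stq_weight w = \sum_(w <- perms n.+1 | Q w) stq_weight w.
Proof.
move=> H; pose X i : {mpoly int[3]} := ('X_(inord i))%R.
pose x i := X 1%N * X 2 ^+ i.
have wE w : stq_weight w = X 0%N ^+ ides w * desprod x 1 w.
  by rewrite desprod_stat mul0n addn0 mulrA.
under eq_bigr => w _ do rewrite wE.
under [RHS]eq_bigr => w _ do rewrite wE.
have bnd s : s \in perms n.+1 -> (ides s < n.+2)%N \/ X 0%N ^+ ides s = 0.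
  case/perms_facts=> _ sn _; left; rewrite ltnS (leq_trans (des_le _)) //.
  by rewrite size_map size_iota sn.
rewrite !(sum_by_stat (g := fun i => X 0%N ^+ i) _ _ bnd); apply: eq_bigr => i _.
by congr (_ * _); apply: eq_sum_stat => m; apply: H.
Qed.

Theorem theorem1p1 (n : nat) (hn : (1 <= n)%N) :
  (\sum_(w <- perms n | andreI w) stq_weight w
     = \sum_(w <- perms n | andreII w) stq_weight w)
  /\
  (\sum_(w <- perms n | andreII w) stq_weight w
     = \sum_(w <- perms n | simsun n w) stq_weight w).
Proof.
have EI w : w \in perms n -> andreI w = andre true w by rewrite andreI_andre.
have EII w : w \in perms n -> andreII w = andre false w.
  by case/perms_facts=> uw _ _; rewrite andreII_andre.
have ES w : w \in perms n -> simsun n w = simsun_word w by apply: simsun_permE.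
have sumE (P Q : pred (seq nat)) : (forall w, w \in perms n -> P w = Q w) ->
    \sum_(w <- perms n | P w) stq_weight w = \sum_(w <- perms n | Q w) stq_weight w.
  move=> PQ; rewrite big_seq_cond [RHS]big_seq_cond; apply: eq_bigl => w.
  by case wp: (w \in _); rewrite //= PQ.
rewrite (sumE _ _ EI) (sumE _ _ EII) (sumE _ _ ES).
case: n hn {EI EII ES sumE} => // n _.
(* Over words of length [n.+1] all three generating functions are the same sum of values of [esol];
   the other goals are invariance under relabelling. *)
split; apply: eq_stq_sum => m R x; rewrite -!sum_words_perms.
- by rewrite [LHS]andreI_sum_esol [RHS]andreII_sum_esol.
- by move=> f w; apply: andre_map.
- by move=> f w; apply: andre_map.
- by rewrite [LHS]andreII_sum_esol simsun_sum_esol.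
- by move=> f w; apply: simsun_word_map.
- by move=> f w; apply: andre_map.
Qed.
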